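(* Let $(A,\leq,{}',0,1)$ be a finite orthomodular poset, let $(T,R)$ be a time frame, and let $P,G\colon A^T\to(2^A\setminus\{\emptyset\})^T$ be the tense operators $P(q)(s)=\operatorname{Min}U(\{q(t)\mid t\mathrel Rs\})$ and $G(q)(s)=\operatorname{Max}L(\{q(t)\mid s\mathrel Rt\})$. Then the couple $(P,G)$ forms a dynamic pair, i.e. (P1) $G(1)=1$ and $P(0)=0$ (where $0,1$ denote the constant functions $T\to A$); (P2) if $p,q\in A^T$ and $p\leq q$ then $G(p)\leq_1G(q)$ and $P(p)\leq_2P(q)$; (P3) if $q\in A^T$ then $q\leq_1(G*P)(q)$ and $(P*G)(q)\leq_2q$.
   Context: An orthomodular poset is a bounded poset $(A,\leq,0,1)$ with a unary operation ${}'$ that is an antitone involution ($a\leq b\Rightarrow b'\leq a'$, $a''=a$) and a complementation ($a\vee a'=1$, $a\wedge a'=0$), such that (i) if $x\leq y'$ then $x\vee y=\sup(x,y)$ exists, and (ii) if $x\leq y$ then $y=x\vee(y\wedge x')$. For $B\subseteq A$: $L(B)=\{x\in A\mid x\leq b\text{ for all }b\in B\}$, $U(B)=\{x\in A\mid b\leq x\text{ for all }b\in B\}$; $\operatorname{Max}B$ and $\operatorname{Min}B$ are the sets of maximal and minimal elements of $B$. A time frame is a pair $(T,R)$ with $T\neq\emptyset$ and $R\subseteq T^2$ serial (for each $s\in T$ there are $r,t\in T$ with $r\mathrel Rs$ and $s\mathrel Rt$). The tense operators are extended to nonempty $B\subseteq A^T$ by $P(B)(s)=\operatorname{Min}U(\{q(t)\mid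 q\in B,\ t\mathrel Rs\})$ and $G(B)(s)=\operatorname{Max}L(\{q(t)\mid q\in B,\ s\mathrel Rt\})$ (a single $q\in A^T$ is identified with $\{q\}$). The transformation function $\varphi\colon(2^A\setminus\{\emptyset\})^T\to2^{(A^T)}\setminus\{\emptyset\}$ is $\varphi(x)=\{q\in A^T\mid q(t)\in x(t)\text{ for all }t\in T\}$, and $G*P:=G\circ\varphi\circ P$, $P*G:=P\circ\varphi\circ G$. For nonempty $B,C\subseteq A$: $B\leq_1C$ iff for every $b\in B$ there is $c\in C$ with $b\leq c$; $B\leq_2C$ iff for every $c\in C$ there is $b\in B$ with $b\leq c$. For $x,y\in(2^A\setminus\{\emptyset\})^T$, $x\leq_iy$ iff $x(t)\leq_iy(t)$ for all $t\in T$; elements $a\in A$ are identified with $\{a\}$ and $p\in A^T$ with $t\mapsto\{p(t)\}$; $p\leq q$ for $p,q\in A^T$ means $p(t)\leq q(t)$ for all $t$. *)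

(* Defs.v *)
(* [T] may be infinite, so subsets of [T -> A] are taken in [set (T -> A)]. *)
From mathcomp Require Import all_boot all_order.
From mathcomp Require Import boolp classical_sets.

Set Implicit Arguments.
Unset Strict Implicit.
Unset Printing Implicit Defensive.

Import Order.TTheory.

Local Open Scope classical_set_scope.
Local Open Scope order_scope.

(* Joins and meets are partial, hence relations: [z] is the join of [x] and [y]
   iff [supremums [set x; y] z]. *)
Definition is_join d (A : porderType d) (x y z : A) : Prop :=
  supremums [set x; y] z.
Definition is_meet d (A : porderType d) (x y z : A) : Prop :=
  infimums [set x; y] z.

Record orthomodular_poset d (A : tbPOrderType d) (compl : A -> A) : Prop :=
  OrthomodularPoset {
    omp_antitone : forall a b : A, a <= b -> compl b <= compl a;
    omp_involution : forall a : A, compl (compl a) = a;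
    omp_join_compl : forall a : A, is_join a (compl a) \top;
    omp_meet_compl : forall a : A, is_meet a (compl a) \bot;
    omp_orthojoin : forall x y : A, x <= compl y -> exists z, is_join x y z;
    (* [y = x \/ (y /\ x')], where both operations are required to exist *)
    omp_orthomodular : forall x y : A, x <= y ->
      exists z, is_meet y (compl x) z /\ is_join x z y
  }.

Record time_frame (T : Type) (R : T -> T -> Prop) : Prop := TimeFrame {
  tf_nonempty : inhabited T;
  tf_serial : forall s : T, exists r t : T, R r s /\ R s t
}.

(* [neset X] is [2^X \ {set0}]. *)
Record neset (X : Type) := NESet {
  ne_val : set X;
  ne_prop : ne_val !=set0
}.

Lemma neset_eq (X : Type) (B C : neset X) : ne_val B = ne_val C -> B = C.
Proof.
case: B C => [B B0] [C C0] /= BC; subst C.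
by congr NESet; exact: Prop_irrelevance.
Qed.

Lemma set1_neq0 (X : Type) (x : X) : [set x] !=set0.
Proof. by exists x. Qed.

Definition ne1 (X : Type) (x : X) : neset X := NESet (set1_neq0 x).

(* The identification of [p : T -> A] with [t |-> {p t}]. *)
Definition pt1 (T A : Type) (p : T -> A) : T -> neset A := fun t => ne1 (p t).

Section MaxMin.
Context d (A : finTBPOrderType d).
Implicit Types B : set A.

Definition Max B : set A := [set x | B x /\ forall y, B y -> ~~ (x < y)].
Definition Min B : set A := [set x | B x /\ forall y, B y -> ~~ (y < x)].

Lemma Max_neq0 B : B !=set0 -> Max B !=set0.
Proof.
case=> x Bx; have [n] := ubnP #|[pred y | x < y]|.
elim: n x Bx => // n IH x Bx; rewrite ltnS => le_n.
have [[y [By xy]]|noy] := pselect (exists y, B y /\ x < y).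
  apply: (IH y By); apply: leq_trans le_n; apply: proper_card.
  apply/properP; split; first by apply/fintype.subsetP => z; rewrite !inE; exact: lt_trans xy.
  by exists y; rewrite !inE ?ltxx.
by exists x; split=> // y By; apply/negP => xy; apply: noy; exists y.
Qed.

Lemma Min_neq0 B : B !=set0 -> Min B !=set0.
Proof.
case=> x Bx; have [n] := ubnP #|[pred y | y < x]|.
elim: n x Bx => // n IH x Bx; rewrite ltnS => le_n.
have [[y [By yx]]|noy] := pselect (exists y, B y /\ y < x).
  apply: (IH y By); apply: leq_trans le_n; apply: proper_card.
  apply/properP; split.
    by apply/fintype.subsetP => z; rewrite !inE => zy; exact: lt_trans yx.
  by exists y; rewrite !inE ?ltxx.
by exists x; split=> // y By; apply/negP => xy; apply: noy; exists y.
Qed.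

Lemma MaxL_neq0 B : Max (lbound B) !=set0.
Proof. by apply: Max_neq0; exists \bot => y _; exact: le0x. Qed.

Lemma MinU_neq0 B : Min (ubound B) !=set0.
Proof. by apply: Min_neq0; exists \top => y _; exact: lex1. Qed.

Definition MaxL B : neset A := NESet (MaxL_neq0 B).
Definition MinU B : neset A := NESet (MinU_neq0 B).

End MaxMin.

Section Tense.
Context d (A : finTBPOrderType d) (T : Type) (R : T -> T -> Prop).

(* The extended operators; their values at a single [q : T -> A] are those at
   [ne1 q], see [tensePE] and [tenseGE]. *)
Definition tenseP (B : neset (T -> A)) (s : T) : neset A :=
  MinU [set a | exists q t, [/\ ne_val B q, R t s & a = q t]].
Definition tenseG (B : neset (T -> A)) (s : T) : neset A :=
  MaxL [set a | exists q t, [/\ ne_val B q, R s t & a = q t]].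

Lemma tensePE (q : T -> A) (s : T) :
  ne_val (tenseP (ne1 q) s) = Min (ubound [set q t | t in [set t | R t s]]).
Proof.
congr (Min (ubound _)); apply/seteqP; split=> a /=.
  by move=> [_ [t [-> Rts ->]]]; exists t.
by move=> [t Rts <-]; exists q, t.
Qed.

Lemma tenseGE (q : T -> A) (s : T) :
  ne_val (tenseG (ne1 q) s) = Max (lbound [set q t | t in [set t | R s t]]).
Proof.
congr (Max (lbound _)); apply/seteqP; split=> a /=.
  by move=> [_ [t [-> Rst ->]]]; exists t.
by move=> [t Rst <-]; exists q, t.
Qed.

End Tense.

Section Transformation.
Context (T A : Type).

Lemma phi_neq0 (x : T -> neset A) :
  [set q : T -> A | forall t, ne_val (x t) (q t)] !=set0.
Proof.
exists (fun t => sval (cid (ne_prop (x t)))) => t /=.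
exact: (svalP (cid (ne_prop (x t)))).
Qed.

Definition phi (x : T -> neset A) : neset (T -> A) := NESet (phi_neq0 x).

(* [star F H] is [F * H]. *)
Definition star (F H : neset (T -> A) -> T -> neset A) :
  neset (T -> A) -> T -> neset A := fun B => F (phi (H B)).

End Transformation.

Section Dynamic.
Context d (A : finTBPOrderType d) (T : Type).
Implicit Types (B C : neset A) (x y : T -> neset A).

Definition le1 B C : Prop :=
  forall b, ne_val B b -> exists c, ne_val C c /\ b <= c.
Definition le2 B C : Prop :=
  forall c, ne_val C c -> exists b, ne_val B b /\ b <= c.
Definition fle1 x y : Prop := forall t, le1 (x t) (y t).
Definition fle2 x y : Prop := forall t, le2 (x t) (y t).

Definition fle (p q : T -> A) : Prop := forall t, p t <= q t.

Record dynamic_pair (P G : neset (T -> A) -> T -> neset A) : Prop :=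
  DynamicPair {
    dynamic_P1 : G (ne1 (fun=> \top)) = pt1 (fun=> \top) /\
                 P (ne1 (fun=> \bot)) = pt1 (fun=> \bot);
    dynamic_P2 : forall p q : T -> A, fle p q ->
                 fle1 (G (ne1 p)) (G (ne1 q)) /\ fle2 (P (ne1 p)) (P (ne1 q));
    dynamic_P3 : forall q : T -> A,
                 fle1 (pt1 q) (star G P (ne1 q)) /\
                 fle2 (star P G (ne1 q)) (pt1 q)
  }.

End Dynamic.

(* Main.v *)
Require Import Defs.
From mathcomp Require Import all_boot all_order.
From mathcomp Require Import boolp classical_sets.

(** In a finite poset every element of a set lies below a maximal one and above
a minimal one. For (P3), every [r] in [phi (P q)] satisfies [q s <= r t] whenever
[R s t], so [q s] is itself a lower bound of the set whose maximal lower bounds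
form [(G * P) q s]; the other half is dual. *)

Import Order.TTheory.

Local Open Scope classical_set_scope.
Local Open Scope order_scope.

(** Apply [Max_neq0] to the part of [B] above [x]: an element of [B] above a maximal [y] of that
    part is again above [x], so [y] is maximal in all of [B]. *)
Lemma Max_ge (d : Order.disp_t) (A : finTBPOrderType d) (B : set A) (x : A) :
  B x -> exists y, Max B y /\ x <= y.
Proof.
move=> Bx.
have [|y [[By xy] ymax]] := @Max_neq0 _ A (B `&` [set y | x <= y]).
  by exists x; split => /=.
exists y; split=> //; split=> // z Bz; apply/negP => yz.
have /negP := ymax z (conj Bz (le_trans xy (ltW yz))).
exact.
Qed.

Lemma Min_le (d : Order.disp_t) (A : finTBPOrderType d) (B : set A) (x : A) :
  B x -> exists y, Min B y /\ y <= x.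
Proof.
move=> Bx.
have [|y [[By yx] ymin]] := @Min_neq0 _ A (B `&` [set y | y <= x]).
  by exists x; split => /=.
exists y; split=> //; split=> // z Bz; apply/negP => zy.
have /negP := ymin z (conj Bz (le_trans (ltW zy) yx)).
exact.
Qed.

Lemma Max_top (d : Order.disp_t) (A : finTBPOrderType d) (B : set A) :
  B \top -> Max B = [set \top].
Proof.
move=> Btop; apply/seteqP; split=> x /=.
  by case=> _ /(_ _ Btop); rewrite ltx1 negbK => /eqP.
by move=> ->; split=> // y _; rewrite lt1x.
Qed.

Lemma Min_bot (d : Order.disp_t) (A : finTBPOrderType d) (B : set A) :
  B \bot -> Min B = [set \bot].
Proof.
move=> Bbot; apply/seteqP; split=> x /=.
  by case=> _ /(_ _ Bbot); rewrite lt0x negbK => /eqP.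
by move=> ->; split=> // y _; rewrite ltx0.
Qed.

(** Reduces a [le1] goal with target [tenseG] to a pointwise inequality: such an [a] is a lower
    bound, and [Max_ge] puts a maximal lower bound above it. *)
Lemma tenseG_ge (d : Order.disp_t) (A : finTBPOrderType d) (T : Type)
    (R : T -> T -> Prop) (B : neset (T -> A)) (s : T) (a : A) :
  (forall q t, ne_val B q -> R s t -> a <= q t) ->
  exists c, ne_val (tenseG R B s) c /\ a <= c.
Proof. by move=> aB; apply: Max_ge => _ [q [t [Bq Rst ->]]]; apply: aB. Qed.

Lemma tenseP_le (d : Order.disp_t) (A : finTBPOrderType d) (T : Type)
    (R : T -> T -> Prop) (B : neset (T -> A)) (s : T) (a : A) :
  (forall q t, ne_val B q -> R t s -> q t <= a) ->
  exists c, ne_val (tenseP R B s) c /\ c <= a.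
Proof. by move=> Ba; apply: Min_le => _ [q [t [Bq Rts ->]]]; apply: Ba. Qed.

Lemma tenseG_lbound (d : Order.disp_t) (A : finTBPOrderType d) (T : Type)
    (R : T -> T -> Prop) (B : neset (T -> A)) (s t : T) (a : A) (q : T -> A) :
  ne_val (tenseG R B s) a -> ne_val B q -> R s t -> a <= q t.
Proof. by case=> aB _ Bq Rst; apply: aB; exists q, t. Qed.

Lemma tenseP_ubound (d : Order.disp_t) (A : finTBPOrderType d) (T : Type)
    (R : T -> T -> Prop) (B : neset (T -> A)) (s t : T) (a : A) (q : T -> A) :
  ne_val (tenseP R B s) a -> ne_val B q -> R t s -> q t <= a.
Proof. by case=> Ba _ Bq Rts; apply: Ba; exists q, t. Qed.

Theorem theorem7 (d : Order.disp_t) (A : finTBPOrderType d) (compl : A -> A)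
    (T : Type) (R : T -> T -> Prop) :
  orthomodular_poset compl -> time_frame R ->
  dynamic_pair (@tenseP d A T R) (@tenseG d A T R).
Proof.
move=> _ _; split.
- split; apply/funext => s; apply: neset_eq.
    (* All values in question equal [\top], so [\top] is itself a lower bound of them. *)
    by apply: Max_top => _ [_ [t [-> _ ->]]].
  by apply: Min_bot => _ [_ [t [-> _ ->]]].
- move=> p q le_pq; split=> s a Ha.
    (* A lower bound of the values of [p] at the successors of [s] is one for [q] too. *)
    apply: tenseG_ge => _ t -> Rst; apply: le_trans (le_pq t).
    exact: tenseG_lbound Ha _ Rst.
  apply: tenseP_le => _ t -> Rts; apply: (le_trans (le_pq t)).
  exact: tenseP_ubound Ha _ Rts.
- move=> q; split=> s _ ->.
    (* Membership of [r] in [phi], read at [t], makes [r t] an upper bound of the values of [q] at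
       the predecessors of [t], and [s] is one of these. *)
    by apply: tenseG_ge => r t /(_ t) Pr Rst; apply: tenseP_ubound Pr _ Rst.
  by apply: tenseP_le => r t /(_ t) Gr Rts; apply: tenseG_lbound Gr _ Rts.
Qed.
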